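(* Let $d\ge 2$, and let $b=b(n)\to\infty$ and $k=k(n)\to\infty$ (as $n\to\infty$) be sequences of positive integers with $b\ge k$ and $n/(bk+k^d)\to 0$. There exists no estimator $V_n\in\widetilde{\mathcal{H}}_{d,b}^k$ such that, for all $\varepsilon>0$, the following limit holds: $$\sup_{p\in\mathcal{D}_d}P\left(\|V_n-p\|_1>3\min_{q\in\widetilde{\mathcal{H}}_{d,b}^k}\|p-q\|_1+\varepsilon\right)\to 0\quad(n\to\infty),$$ where $V_n$ is a function of $X_1,\ldots,X_n\overset{iid}{\sim}p$.
   Context: $[b]=\{1,\ldots,b\}$. $\mathcal{D}_d$ is the set of all probability densities on $[0,1)^d$ (with respect to $d$-dimensional Lebesgue measure); $\|\cdot\|_1$ is the $L^1$ norm. $\mathcal{T}_{d,k}$ is the set of order-$d$ tensors $W\in\mathbb{R}^{k\times\cdots\times k}$ ($d$ modes, indexed by $[k]^d$) with nonnegative entries summing to one. For $i\in[b]$, let $h_{1,b,i}(x)=b\,\mathbf{1}\left(\frac{i-1}{b}\le x<\frac{i}{b}\right)$ on $[0,1)$, and let $\mathcal{H}_{1,b}$ be the convex hull of $\{h_{1,b,i}: i\in[b]\}$. For univariate functions, $\prod_{j=1}^d p_j$ denotes $(x_1,\ldots,x_d)\mapsto\prod_{j=1}^d p_j(x_j)$. The set of Tucker histograms is $$\widetilde{\mathcal{H}}_{d,b}^k=\left\{\sum_{S\in[k]^d}W_S\prod_{i=1}^d p_{i,S_i}\;:\;W\in\mathcal{T}_{d,k},\ p_{i,j}\in\mathcal{H}_{1,b}\right\}.$$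 An estimator $V_n\in\widetilde{\mathcal{H}}_{d,b}^k$ is (for each $n$) a function of the sample, not depending on $p$, with values in $\widetilde{\mathcal{H}}_{d,b}^k$. *)

(* Defs.v *)
From HB Require Import structures.
From mathcomp Require Import all_boot all_order all_algebra.
From mathcomp Require Import all_classical all_reals all_analysis.
From mathcomp Require Import measurable_realfun.

Set Implicit Arguments.
Unset Strict Implicit.
Unset Printing Implicit Defensive.

Import Order.TTheory GRing.Theory Num.Theory.
Import numFieldNormedType.Exports.

Local Open Scope classical_set_scope.
Local Open Scope ring_scope.

Section power_probability.
Local Open Scope ereal_scope.
Context d (T : measurableType d) (R : realType) (P : probability T R).

Definition tcons n (xt : T * n.-tuple T) : n.+1.-tuple T :=
  [tuple of xt.1 :: xt.2].

Lemma measurable_tcons n : measurable_fun [set: T * n.-tuple T] (@tcons n).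
Proof. by apply: measurable_cons. Qed.

HB.instance Definition _ n :=
  isMeasurableFun.Build _ _ _ _ (@tcons n) (@measurable_tcons n).

(* The n-fold product P x ... x P, i.e. the law of n iid draws from P;
   power_probability_box below characterizes it. *)
Fixpoint power_probability (n : nat) : probability (n.-tuple T) R :=
  match n with
  | 0 => \d_([tuple] : 0.-tuple T)
  | m.+1 => distribution (P \x power_probability m) (@tcons m)
  end.

Lemma power_probability_box n (A : 'I_n -> set T) :
  (forall i, measurable (A i)) ->
  power_probability n [set x | forall i, A i (tnth x i)] =
  \prod_(i < n) P (A i).
Proof.
elim: n A => [|n IH] A mA /=.
  rewrite big_ord0 /dirac indicE mem_set//= => -[] //.
rewrite big_ord_recl -IH//.
rewrite -product_measure1E//=.
  rewrite /distribution /pushforward; congr (_ \x _)%E.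
  apply/seteqP; split => [[x t] /= Axt|[x t] /= [Ax At] i].
    split; first exact: (Axt ord0).
    by move=> i; have := Axt (lift ord0 i); rewrite tnthS.
  have [j ->|->] := unliftP ord0 i; first by rewrite tnthS.
  by [].
rewrite (_ : [set _ | _] =
  \bigcap_(i in [set: 'I_n]) ((@tnth _ T ^~ i) @^-1` A (lift ord0 i))).
  apply: fin_bigcap_measurable => // i _.
  by rewrite -[X in measurable X]setTI; exact: measurable_tnth.
by apply/seteqP; split => [x Ax i _|x Ax i]; [exact: Ax|exact: Ax].
Qed.

End power_probability.

Section lebesgue_cube.
Local Open Scope ereal_scope.
Context (R : realType).

Definition lebesgue01 : set (measurableTypeR R) -> \bar R :=
  mrestr (@lebesgue_measure R) (measurable_itv `[0%R, 1%R[).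

HB.instance Definition _ := Measure.on lebesgue01.

Let lebesgue01_setT : lebesgue01 [set: _] = 1.
Proof.
by rewrite /lebesgue01 /mrestr setTI lebesgue_measure_itv/= lte01 oppr0 adde0.
Qed.

HB.instance Definition _ :=
  Measure_isProbability.Build _ _ _ lebesgue01 lebesgue01_setT.

(* Lebesgue measure of [0,1)^d, as a measure on R^d carried by the cube.
   Functions on [0,1)^d are thus represented by functions on R^d, whose values
   outside the cube are irrelevant. *)
Definition lebesgue_cube (d : nat) :
    probability (d.-tuple (measurableTypeR R)) R :=
  power_probability lebesgue01 d.

End lebesgue_cube.
Arguments lebesgue_cube : clear implicits.

Notation Rvec R d := (d.-tuple (measurableTypeR R)).

Definition L1dist (R : realType) (d : nat) (f g : Rvec R d -> R) : \bar R :=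
  'N[lebesgue_cube R d]_1 [EFin \o (f \- g)%R]%E.

(* For the classes C considered here the infimum is a minimum (C is the
   continuous image in L1 of a compact set of coefficients). *)
Definition L1dist_to (R : realType) (d : nat) (p : Rvec R d -> R)
    (C : set (Rvec R d -> R)) : \bar R :=
  ereal_inf [set L1dist p q | q in C].

Section density.
Local Open Scope ereal_scope.
Context (R : realType) (d : nat).

Record density := Density {
  density_fun :> Rvec R d -> R;
  measurable_density : measurable_fun [set: Rvec R d] density_fun;
  density_ge0 : forall x, (0 <= density_fun x)%R;
  density_integral : \int[lebesgue_cube R d]_x (density_fun x)%:E = 1 }.

Variable p : density.

Definition law (A : set (Rvec R d)) : \bar R :=
  \int[lebesgue_cube R d]_(x in A) (p x)%:E.

Let law0 : law set0 = 0.
Proof. exact: integral_set0. Qed.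

Let law_ge0 A : 0 <= law A.
Proof. by apply: integral_ge0 => x _; rewrite lee_fin density_ge0. Qed.

Let law_sigma_additive : semi_sigma_additive law.
Proof.
move=> F mF tF mUF; rewrite /law; apply: cvg_toP.
  apply: ereal_nondecreasing_is_cvgn => m n mn.
  by apply: lee_sum_nneg_natr => // k _ _; exact: law_ge0.
rewrite ge0_integral_bigcup//=.
- apply/measurable_EFinP; apply: (measurable_funS measurableT) => //.
  exact: measurable_density.
- by move=> x _; rewrite lee_fin density_ge0.
Qed.

HB.instance Definition _ :=
  isMeasure.Build _ _ _ law law0 law_ge0 law_sigma_additive.

Let law_setT : law [set: _] = 1.
Proof. exact: density_integral. Qed.

HB.instance Definition _ := Measure_isProbability.Build _ _ _ law law_setT.

End density.

(* P(X_1, ..., X_n \in A) for X_1, ..., X_n iid with density p *)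
Definition sample_law (R : realType) (d n : nat) (p : density R d) :
    probability (n.-tuple (Rvec R d)) R :=
  power_probability (law p) n.

Section tucker_histograms.
Context (R : realType).

(* Indices are shifted: i in 'I_b = {0, ..., b-1} stands for h_{1,b,i+1}. *)
Definition hist1 (b : nat) (i : 'I_b) : R -> R^o :=
  fun x => if i%:R / b%:R <= x < i.+1%:R / b%:R then b%:R else 0.

Definition convex_hull (E : lmodType R) (A : set E) : set E :=
  smallest (@convex_set R E) A.

Definition histograms1 (b : nat) : set (R -> R^o) :=
  convex_hull [set hist1 i | i in [set: 'I_b]].

Definition prob_tensor (d k : nat) (W : d.-tuple 'I_k -> R) : Prop :=
  (forall S, 0 <= W S) /\ \sum_S W S = 1.

Definition tucker_histograms (d b k : nat) : set (Rvec R d -> R) :=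
  [set f | exists (W : d.-tuple 'I_k -> R) (p : 'I_d -> 'I_k -> R -> R),
    [/\ prob_tensor W,
        (forall i j, histograms1 b (p i j)) &
        f = fun x => \sum_S W S * \prod_(i < d) p i (tnth S i) (tnth x i)]].

End tucker_histograms.

(* The metric space of densities with the L1 distance is separable, so the
   measurability clause says exactly that V is measurable for its Borel
   sigma-algebra. *)
Definition estimator (R : realType) (d n : nat) (C : set (Rvec R d -> R))
    (V : n.-tuple (Rvec R d) -> Rvec R d -> R) : Prop :=
  (forall X, C (V X)) /\
  (forall p : density R d,
     measurable_fun [set: n.-tuple (Rvec R d)] (fun X => L1dist (V X) p)).

(* Main.v *)
Require Import Defs.
From mathcomp Require Import all_boot all_order all_algebra.
From mathcomp Require Import all_classical all_reals all_analysis.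
From mathcomp Require Import measurable_realfun zify lra.

Import Order.TTheory GRing.Theory Num.Theory.
Import numFieldNormedType.Exports.

Local Open Scope classical_set_scope.
Local Open Scope ring_scope.

Set Implicit Arguments.
Unset Strict Implicit.
Unset Printing Implicit Defensive.

(** Every histogram of the class is at distance 0 from the class, so a
    consistent estimator would have to be L1-consistent on the class itself,
    uniformly.  Assouad's method rules this out as soon as the class contains a
    hypercube of dimension M with n / M small.

    The hypercube.  Take M disjoint pairs of cells (boxes of side 1/b) and let a
    vertex [th : {ffun C -> bool}], #|C| = M, be the density that puts mass 1/M
    on one cell of each pair, [th] telling which one ([vertex]).  Two vertices
    are at L1 distance 2/M times their Hamming distance ([L1dist_vertex]), and
    flipping one coordinate of [th] changes the density on the corresponding
    pair only.

    Why the vertices are indistinguishable.  A sample of size n misses a given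
    pair with probability (1 - 1/M)^n >= 1 - n/M, and on that event its law does
    not depend on the coordinate of [th] attached to the pair
    ([power_probability_agree]).  Hence any guess of that coordinate errs with
    probability at least (1 - n/M)/2 on average over [th], and some vertex makes
    a nonnegligible fraction of the guesses wrong with a probability bounded
    below ([assouad]).  An estimator yields such a guess: output a vertex at
    distance at most eta from the estimate, if there is one.  If the estimate
    is eta-close to the true vertex, then the guess is 2 eta-close to it, so at
    most eta M of its coordinates are wrong ([hypercube_lower_bound]).

    Two hypercubes of Tucker histograms.  The d-dimensional tensor W can carry
    arbitrary weights on k^d cells, which gives M = floor(k/2) k^(d-1)
    ([vertex_tensor_tucker]).  With W diagonal, the k histograms of the first
    variable are free in the b bins, which gives M = floor(b/2) k
    ([vertex_diagonal_tucker]).  For k >= 2 the larger of the two is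
    at least (b k + k^d)/6 ([tucker_minimax]), so n / M tends to 0. *)

(** * Assouad's lemma for finite-valued decoders *)

Section finite_valued_statistics.
Context d (T : measurableType d) (R : realType) (F : finType) (g : T -> F).
Hypothesis mg : forall t, measurable (g @^-1` [set t]).

Lemma measurable_preimage_fin (S : set F) : measurable (g @^-1` S).
Proof.
rewrite (_ : _ @^-1` _ = \bigcup_(t in S) (g @^-1` [set t])).
  by apply: fin_bigcup_measurable => //; exact: finite_finset.
by apply/seteqP; split => [x Sx|x [t St] /= ->//]; exists (g x).
Qed.

Lemma fine_preimage_fin (P : probability T R) (p : pred F) :
  fine (P (g @^-1` [set t | p t])) =
  \sum_(t | p t) fine (P (g @^-1` [set t])).
Proof.
rewrite -big_filter; set s := seq.filter _ _.
have us : uniq s by rewrite filter_uniq// index_enum_uniq.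
rewrite (_ : [set t | p t] = [set t | t \in s]); last first.
  by apply/seteqP; split => t /=; rewrite mem_filter mem_index_enum andbT.
elim: s us => [_|t s IH /= /andP[ts us]].
  rewrite big_nil (_ : _ @^-1` _ = set0) ?measure0//.
  by apply/seteqP; split.
rewrite big_cons -IH//.
rewrite (_ : _ @^-1` _ = g @^-1` [set t] `|` g @^-1` [set u | u \in s]).
  rewrite measureU ?fineD ?fin_num_measure//; last 3 first.
  - exact: measurable_preimage_fin.
  - exact: measurable_preimage_fin.
  - by apply/seteqP; split => // x [/= ->]; rewrite (negbTE ts).
apply/seteqP; split => x /=; rewrite inE.
  by case/orP => [/eqP|]; [left|right].
by case=> ->; rewrite ?eqxx ?orbT.
Qed.

End finite_valued_statistics.

Definition flip (C : finType) (c : C) (th : {ffun C -> bool}) :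
  {ffun C -> bool} := [ffun c' => (c' == c) (+) th c'].

Lemma flipK (C : finType) (c : C) : involutive (flip c).
Proof. by move=> th; apply/ffunP => x; rewrite !ffunE addKb. Qed.

Definition hamming (C : finType) (s t : {ffun C -> bool}) : nat :=
  #|[pred c | s c != t c]|.

Lemma hamming_le (C : finType) (s t : {ffun C -> bool}) :
  (hamming s t <= #|C|)%N.
Proof. exact: max_card. Qed.

(** The abstract form of the method.  [Q th] is the law of the data, [N c] an
    event on which the data carry no information about the coordinate [c] of
    [th], and [g] a decoder.  As [g] takes finitely many values, expected losses
    are finite sums of probabilities of its fibres. *)
Section assouad.
Context d (T : measurableType d) (R : realType) (C : finType).
Variables (Q : {ffun C -> bool} -> probability T R) (N : C -> set T).
Variables (g : T -> {ffun C -> bool}) (delta eta : R).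
Hypothesis mg : forall t, measurable (g @^-1` [set t]).
Hypothesis mN : forall c, measurable (N c).
Hypothesis QN : forall th c A, measurable A -> A `<=` N c ->
  Q th A = Q (flip c th) A.
Hypothesis N_large : forall th c, 1 - delta <= fine (Q th (N c)).
Hypothesis eta_ge0 : 0 <= eta.

Let err th c : R := fine (Q th (g @^-1` [set t | t c != th c])).
Let bad th : set T :=
  [set x | eta * #|C|%:R < (hamming (g x) th)%:R].

(* The errors that [g] makes on coordinate [c] under [th] and under [flip c th]
   are complementary events; on [N c] both laws agree, so there the two error
   probabilities add up to the mass of [N c]. *)
Let two_point th c : 1 - delta <= err th c + err (flip c th) c.
Proof.
have mS := measurable_preimage_fin mg.
apply: (le_trans (N_large th c)).
set A := g @^-1` [set t | t c != th c]; set B := g @^-1` [set t | t c == th c].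
have errB : err (flip c th) c = fine (Q (flip c th) B).
  rewrite /err (_ : [set t | t c != flip c th c] = [set t | t c == th c])//.
  by apply/seteqP; split => t /=; rewrite ffunE eqxx/=;
    case: (t c) (th c) => -[].
rewrite errB (_ : N c = (A `&` N c) `|` (B `&` N c)); last first.
  apply/seteqP; split => [x Nx|x [[]|[]]//].
  by case: (boolP (g x c == th c)) => ?; [right|left].
rewrite measureU; last 3 first.
- by apply: measurableI => //; exact: mS.
- by apply: measurableI => //; exact: mS.
- by apply/seteqP; split => // x [[/= /negP nBx _] [/= /nBx]].
rewrite fineD ?fin_num_measure//; [|by apply: measurableI => //; exact: mS..].
have fle (P : probability T R) X : measurable X ->
    fine (P (X `&` N c)) <= fine (P X).
  move=> mX; apply: fine_le; rewrite ?fin_num_measure//.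
    exact: measurableI.
  by apply: le_measure; rewrite ?inE//; exact: measurableI.
apply: lerD; first by apply: fle; exact: mS.
have := fle (Q (flip c th)) B (mS _).
by rewrite -QN//; apply: measurableI => //; exact: mS.
Qed.

(* The left-hand side is the expected Hamming loss of [g], which is at most
   [eta * #|C|] off the event [bad th] and at most [#|C|] on it. *)
Let sum_err th :
  \sum_c err th c <= (eta + fine (Q th (bad th))) * #|C|%:R.
Proof.
pose q t := fine (Q th (g @^-1` [set t])).
have q1 : \sum_t q t = 1.
  have /= := fine_preimage_fin mg (Q th) predT.
  rewrite (_ : _ @^-1` _ = setT) ?probability_setT//.
  by apply/seteqP.
have q0 t : 0 <= q t by exact: fine_ge0.
have -> : \sum_c err th c = \sum_t q t * (hamming t th)%:R.
  under eq_bigr do rewrite /err (fine_preimage_fin mg).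
  under eq_bigr do rewrite big_mkcond/=.
  rewrite exchange_big/=; apply: eq_bigr => t _.
  rewrite /hamming -sum1_card natr_sum mulr_sumr big_mkcond [RHS]big_mkcond/=.
  by apply: eq_bigr => c _; rewrite inE/= mulr1.
have -> : (eta + fine (Q th (bad th))) * #|C|%:R =
    \sum_t q t * (eta * #|C|%:R) + fine (Q th (bad th)) * #|C|%:R.
  by rewrite -mulr_suml q1 mul1r mulrDl.
have -> : bad th = g @^-1` [set t | eta * #|C|%:R < (hamming t th)%:R] by [].
rewrite (fine_preimage_fin mg) mulr_suml [X in _ + X]big_mkcond -big_split/=.
apply: ler_sum => t _; rewrite -/(q t); case: ifPn => [_|].
  apply: ler_wpDl; first by do 2!apply: mulr_ge0 => //; exact: q0.
  by apply: ler_wpM2l; [exact: q0|rewrite ler_nat hamming_le].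
by rewrite -leNgt addr0 => good; apply: ler_wpM2l => //; exact: q0.
Qed.

(** Averaging the two-point bound over the pairs [th], [flip c th] and over [c]
    bounds below the mean over [th] of the expected Hamming loss; some [th]
    attains at least this mean. *)
Lemma assouad : (0 < #|C|)%N ->
  exists th, (1 - delta) / 2 - eta <= fine (Q th (bad th)).
Proof.
move=> C0; apply: contrapT => /forallNP small.
have M0 : 0 < #|C|%:R :> R by rewrite ltr0n.
have lower : \sum_(th : {ffun C -> bool}) \sum_(c : C) (1 - delta) <=
    2 * \sum_th \sum_c err th c.
  rewrite [leLHS]exchange_big [X in _ <= 2 * X]exchange_big/= mulr_sumr.
  apply: ler_sum => c _; rewrite mulr_natl mulr2n.
  (* Half of the doubled sum is reindexed by the involution [flip c]. *)
  rewrite [X in _ <= _ + X](reindex_inj (inv_inj (@flipK C c)))/= -big_split/=.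
  by apply: ler_sum => th _; exact: two_point.
have upper : 2 * \sum_th \sum_c err th c <
    \sum_(th : {ffun C -> bool}) \sum_(c : C) (1 - delta).
  rewrite mulr_sumr; apply: ltr_sum => [|th _].
    by apply/hasP; exists [ffun=> true]; rewrite ?mem_index_enum.
  apply: (le_lt_trans (ler_wpM2l _ (sum_err th))) => //.
  rewrite sumr_const -[X in _ < X]mulr_natr mulrA ltr_pM2r//.
  by move: (small th) => /negP; rewrite -ltNge => h; lra.
by move: (le_lt_trans lower upper); rewrite ltxx.
Qed.

End assouad.

(** * Laws of samples that avoid a set *)

Section power_probability_lemmas.
Context d (T : measurableType d) (R : realType).

(** A sample staying in [N] cannot tell apart two laws that coincide inside [N].
    By induction on the sample size: the section at [x] of an event included in
    N x ... x N is empty unless [x] is in [N], so the outer integral only sees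
    the common restriction of the two laws. *)
Lemma power_probability_agree (P P' : probability T R) (N : set T) n
    (A : set (n.-tuple T)) :
  (forall B, measurable B -> B `<=` N -> P B = P' B) ->
  measurable A -> A `<=` [set x | forall i, N (tnth x i)] ->
  power_probability P n A = power_probability P' n A.
Proof.
move=> PP'; elim: n A => [//|n IH] A mA AN /=.
rewrite /distribution /pushforward /= /product_measure1.
set B := _ @^-1` A.
have mB : measurable B.
  by rewrite /B -[X in measurable X]setTI; exact: measurable_tcons.
have BN x t : B (x, t) -> N x /\ forall i, N (tnth t i).
  move=> Bxt; have h := AN _ Bxt; split; first exact: (h ord0).
  by move=> i; move: (h (lift ord0 i)); rewrite tnthS.
have restrict_N (m : probability T R) (m' : probability (n.-tuple T) R) :
    (\int[m]_x (m' \o xsection B) x = \int[m]_(x in N) (m' \o xsection B) x)%E.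
  rewrite [RHS]integral_mkcond; apply: eq_integral => x _.
  rewrite patchE; case: ifPn => // /negP xN /=.
  rewrite (_ : xsection B x = set0) ?measure0//.
  apply/seteqP; split => // t; rewrite /xsection/= inE => /BN[Nx _].
  by case: xN; rewrite inE.
rewrite !restrict_N (eq_measure_integral P')//.
apply: eq_integral => x _ /=; apply: IH; first exact: measurable_xsection.
by move=> t; rewrite /xsection/= inE => /BN[].
Qed.

Lemma bernoulli_ineq (x : R) n : 0 <= x <= 1 -> 1 - n%:R * x <= (1 - x) ^+ n.
Proof.
move=> /andP[x0 x1]; elim: n => [|n IH]; first by rewrite mul0r subr0 expr0.
have y0 : 0 <= 1 - x by rewrite subr_ge0.
rewrite exprSr; apply: le_trans (ler_wpM2r y0 IH).
have := mulr_ge0 (mulr_ge0 (ler0n R n) x0) x0.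
by rewrite -natr1; nra.
Qed.

Lemma power_probability_avoid (P : probability T R) (B : set T) n (x : R) :
  measurable B -> P B = x%:E ->
  1 - n%:R * x <=
  fine (power_probability P n [set t | forall i, (~` B) (tnth t i)]).
Proof.
move=> mB PBx.
rewrite (power_probability_box P (fun=> measurableC mB)).
under eq_bigr do rewrite probability_setC// PBx -EFinB.
rewrite prodEFin prodr_const card_ord/=; apply: bernoulli_ineq.
by rewrite -!lee_fin -PBx measure_ge0 probability_le1.
Qed.

End power_probability_lemmas.

(** * Cells of side 1/b and their uniform densities *)

Section cells.
Context (R : realType).

Definition bin b (i : 'I_b) : set R :=
  [set` `[i%:R / b%:R, i.+1%:R / b%:R[].

Lemma hist1E b (i : 'I_b) (x : R) : hist1 i x = b%:R * \1_(bin i) x.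
Proof.
rewrite /hist1 indicE /bin; case: ifPn => xi.
  by rewrite mem_set ?mulr1//= in_itv.
by rewrite memNset ?mulr0//= in_itv/=; exact/negP.
Qed.

Lemma measurable_hist1 b (i : 'I_b) : measurable_fun setT (hist1 i : R -> R).
Proof.
rewrite (_ : hist1 i = fun x => b%:R * \1_(bin i) x); last first.
  by apply/funext => x; rewrite hist1E.
by apply: measurable_funM => //; apply: measurable_indic; exact: measurable_itv.
Qed.

Lemma bin_inj b (i j : 'I_b) (x : R) : bin i x -> bin j x -> i = j.
Proof.
have b0 : (0 : R) < b%:R by rewrite ltr0n; case: b i {j} => [[]|].
rewrite /bin/= !in_itv/= !ler_pdivrMr// !ltr_pdivlMr//.
move=> /andP[ix xi] /andP[jx xj]; apply/val_inj/eqP; rewrite eqn_leq/=.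
rewrite -ltnS -(ltnS j) -!(ltr_nat R).
by rewrite (le_lt_trans ix xj) (le_lt_trans jx xi).
Qed.

Lemma lebesgue01_bin b (i : 'I_b) : lebesgue01 (bin i) = (b%:R^-1)%:E.
Proof.
have b0 : (0 : R) < b%:R by rewrite ltr0n; case: b i => [[]|].
rewrite /lebesgue01 /mrestr setIidl.
  rewrite lebesgue_measure_itv/= lte_fin ltr_pM2r ?invr_gt0// ltr_nat ltnSn.
  by rewrite -EFinB -mulrBl -natrB// subSnn mul1r.
move=> x; rewrite /bin/= !in_itv/= => /andP[ix xi].
rewrite (le_trans _ ix) ?divr_ge0//= (lt_le_trans xi)//.
by rewrite ler_pdivrMr// mul1r ler_nat.
Qed.

Definition cell d b (S : d.-tuple 'I_b) : set (Rvec R d) :=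
  [set x | forall i, bin (tnth S i) (tnth x i)].

Lemma cell_inj d b (S S' : d.-tuple 'I_b) x : cell S x -> cell S' x -> S = S'.
Proof. by move=> Sx S'x; apply: eq_from_tnth => i; exact: bin_inj. Qed.

Lemma measurable_cell d b (S : d.-tuple 'I_b) : measurable (cell S).
Proof.
rewrite (_ : cell S =
    \bigcap_(i in [set: 'I_d]) ((@tnth _ _ ^~ i) @^-1` bin (tnth S i))).
  apply: fin_bigcap_measurable => // i _.
  by rewrite -[X in measurable X]setTI; apply: measurable_tnth => //;
    exact: measurable_itv.
by apply/seteqP; split => [x Sx i _|x Sx i]; [exact: Sx|exact: Sx].
Qed.

Definition cell_density d b (S : d.-tuple 'I_b) (x : Rvec R d) : R :=
  \prod_(i < d) hist1 (tnth S i) (tnth x i).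

(** The product density of bins is the uniform density on the cell: its value is
    b^d there, the inverse of the volume. *)
Lemma cell_densityE d b (S : d.-tuple 'I_b) x :
  cell_density S x = b%:R ^+ d * \1_(cell S) x.
Proof.
rewrite /cell_density; under eq_bigr do rewrite hist1E.
rewrite big_split/= prodr_const card_ord; congr (_ * _).
rewrite [RHS]indicE; case: (asboolP (cell S x)) => Sx.
  by rewrite mem_set// big1// => i _; rewrite indicE mem_set.
rewrite memNset//; move/existsNP: Sx => [i Si].
by rewrite (bigD1 i)//= indicE memNset// mul0r.
Qed.

Lemma cell_density_ge0 d b (S : d.-tuple 'I_b) x : 0 <= cell_density S x.
Proof. by rewrite cell_densityE mulr_ge0// exprn_ge0. Qed.

Lemma measurable_cell_density d b (S : d.-tuple 'I_b) :
  measurable_fun setT (cell_density S).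
Proof.
rewrite (_ : cell_density S = fun x => b%:R ^+ d * \1_(cell S) x); last first.
  by apply/funext => x; rewrite cell_densityE.
apply: measurable_funM => //; apply: measurable_indic.
exact: measurable_cell.
Qed.

Lemma lebesgue_cube_cell d b (S : d.-tuple 'I_b) :
  lebesgue_cube R d (cell S) = ((b%:R^-1) ^+ d)%:E.
Proof.
rewrite /lebesgue_cube [LHS](power_probability_box (@lebesgue01 R)
  (fun i : 'I_d => measurable_itv
    `[(tnth S i)%:R / b%:R, (tnth S i).+1%:R / b%:R[)).
rewrite [LHS](eq_bigr (fun=> (b%:R^-1)%:E)); last first.
  by move=> i _; exact: lebesgue01_bin.
by rewrite prodEFin prodr_const card_ord.
Qed.

Lemma integral_cell_density d b (S : d.-tuple 'I_b) : (0 < b)%N ->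
  (\int[lebesgue_cube R d]_x (cell_density S x)%:E = 1)%E.
Proof.
move=> b0; have bR0 : (b%:R : R) != 0 by rewrite pnatr_eq0 -lt0n.
under eq_integral do rewrite cell_densityE EFinM.
rewrite ge0_integralZl//; last first.
  by apply/measurable_EFinP/measurable_indic; exact: measurable_cell.
rewrite integral_indic//; last exact: measurable_cell.
rewrite setIT; transitivity ((b%:R ^+ d)%:E * ((b%:R^-1 : R) ^+ d)%:E)%E.
  by congr (_ * _)%E; exact: lebesgue_cube_cell.
by rewrite -EFinM -exprMn divff// expr1n.
Qed.

End cells.

(** * The hypercube of densities *)

(** Sums of uniform densities over a subset [P] of a family of distinct cells.
    Since these cells are disjoint, such a sum is determined at a point by the
    at most one cell of the family containing it ([cell_sum_in],
    [cell_sum_out]); both the vertices of the hypercube and the absolute values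
    of their differences are multiples of such sums. *)
Section cell_sums.
Context (R : realType) (d b : nat) (J : finType) (phi : J -> d.-tuple 'I_b).
Hypothesis b_gt0 : (0 < b)%N.
Hypothesis phi_inj : injective phi.

Definition cell_sum (P : pred J) (x : Rvec R d) : R :=
  \sum_(p | P p) cell_density (phi p) x.

Lemma cell_sum_ge0 P x : 0 <= cell_sum P x.
Proof. by apply: sumr_ge0 => p _; exact: cell_density_ge0. Qed.

Lemma measurable_cell_sum P : measurable_fun setT (cell_sum P).
Proof.
rewrite /cell_sum; under eq_fun do rewrite -big_filter.
by apply: measurable_sum => p; exact: measurable_cell_density.
Qed.

Lemma cell_sum_in p P x : cell (phi p) x ->
  cell_sum P x = b%:R ^+ d * (P p)%:R.
Proof.
move=> px; rewrite /cell_sum big_mkcond (bigD1 p)//= big1 => [|q qp].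
  rewrite addr0 cell_densityE indicE mem_set// mulr1.
  by case: (P p); rewrite ?mulr1 ?mulr0.
rewrite cell_densityE indicE memNset ?mulr0 ?if_same// => qx.
by move/eqP: qp; apply; apply: phi_inj; exact: cell_inj qx px.
Qed.

Lemma cell_sum_out P x : (forall p, ~ cell (phi p) x) -> cell_sum P x = 0.
Proof.
move=> xout; rewrite /cell_sum big1// => p _.
by rewrite cell_densityE indicE memNset ?mulr0.
Qed.

Lemma integral_cell_sum (P : pred J) (a : R) : 0 <= a ->
  (\int[lebesgue_cube R d]_x (a * cell_sum P x)%:E = (a * #|P|%:R)%:E)%E.
Proof.
move=> a0; under eq_integral do rewrite EFinM.
rewrite ge0_integralZl//; last 2 first.
- by apply/measurable_EFinP; exact: measurable_cell_sum.
- by move=> x _; rewrite lee_fin cell_sum_ge0.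
rewrite EFinM; congr (_ * _)%E.
under eq_integral do rewrite /cell_sum -big_filter -sumEFin.
rewrite ge0_integral_sum//.
- under eq_bigr do rewrite integral_cell_density//.
  by rewrite big_filter sumEFin sumr_const.
- by move=> p; apply/measurable_EFinP; exact: measurable_cell_density.
- by move=> p x _; rewrite lee_fin cell_density_ge0.
Qed.

End cell_sums.

(** The cells [phi (c, true)] and [phi (c, false)] form the pair attached to the
    coordinate [c]. *)
Section hypercube.
Context (R : realType) (d b : nat) (C : finType).
Variable phi : C * bool -> d.-tuple 'I_b.
Hypothesis b_gt0 : (0 < b)%N.
Hypothesis phi_inj : injective phi.
Hypothesis C_gt0 : (0 < #|C|)%N.
Implicit Types th tau : {ffun C -> bool}.

Let M : R := #|C|%:R.
Let M_gt0 : 0 < M. Proof. by rewrite ltr0n. Qed.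
Let invM_ge0 : 0 <= M^-1. Proof. by rewrite invr_ge0 ltW. Qed.

Definition vertex th (x : Rvec R d) : R :=
  #|C|%:R^-1 * cell_sum phi [pred p | p.2 == th p.1] x.

Lemma vertex_ge0 th x : 0 <= vertex th x.
Proof. by rewrite mulr_ge0 ?cell_sum_ge0. Qed.

Lemma measurable_vertex th : measurable_fun setT (vertex th).
Proof. by apply: measurable_funM => //; exact: measurable_cell_sum. Qed.

Lemma integral_vertex th :
  (\int[lebesgue_cube R d]_x (vertex th x)%:E = 1)%E.
Proof.
rewrite integral_cell_sum// -sum1_card.
rewrite -(pair_big_dep xpredT (fun c e => e == th c) (fun _ _ => 1%N))/=.
under eq_bigr do rewrite big_pred1_eq.
by rewrite sum1_card mulVf// gt_eqF.
Qed.

Definition vertex_density th : density R d :=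
  Density (measurable_vertex th) (vertex_ge0 th) (integral_vertex th).

Definition block (c : C) : set (Rvec R d) :=
  cell (phi (c, true)) `|` cell (phi (c, false)).

Lemma blockP c x : block c x <-> exists e, cell (phi (c, e)) x.
Proof. by split => [[]|[[|]]]; [exists true|exists false|left|right]. Qed.

Lemma measurable_block c : measurable (block c).
Proof. by apply: measurableU; exact: measurable_cell. Qed.

(** Off the pair of cells attached to [c], a density of the hypercube does not
    depend on the coordinate [c]. *)
Lemma vertex_flip th c x : ~ block c x -> vertex th x = vertex (flip c th) x.
Proof.
move=> cx; rewrite /vertex; congr (_ * _).
have [[[c' e] px]|xout] := pselect (exists p, cell (phi p) x); last first.
  by rewrite !cell_sum_out// => p px; apply: xout; exists p.
rewrite !(cell_sum_in phi_inj _ px)//= ffunE; case: (eqVneq c' c) => [c'c|//].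
by case: cx; apply/blockP; exists e; rewrite -c'c.
Qed.

Lemma law_block th c : law (vertex_density th) (block c) = (#|C|%:R^-1)%:E.
Proof.
rewrite /law integral_mkcond.
rewrite (eq_integral
  (fun x => (M^-1 * cell_sum phi (pred1 (c, th c)) x)%:E)).
  by rewrite integral_cell_sum// card1 mulr1.
move=> x _; rewrite patchE /=; case: ifPn => [|/negP].
  rewrite inE => /blockP[e cx]; rewrite /vertex !(cell_sum_in phi_inj _ cx)//=.
  by rewrite xpair_eqE eqxx.
rewrite inE => cx; congr EFin; apply/esym/eqP.
rewrite mulf_eq0; apply/orP; right.
rewrite /cell_sum big_pred1_eq cell_densityE indicE memNset ?mulr0//.
by move=> h; apply: cx; apply/blockP; exists (th c).
Qed.

(** Where [tau] and [th] differ, the masses 1/M sit on two disjoint cells, so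
    that each such coordinate contributes 2/M. *)
Lemma L1dist_vertex tau th :
  L1dist (vertex tau) (vertex th) =
  (2 * (hamming tau th)%:R / #|C|%:R)%:E.
Proof.
rewrite /L1dist Lnorm1.
(* The difference is carried by both cells of every pair on which the two
   vertices differ. *)
rewrite (eq_integral (fun x =>
    (M^-1 * cell_sum phi [pred p | tau p.1 != th p.1] x)%:E)).
  rewrite integral_cell_sum//; congr EFin; rewrite mulrC; congr (_ / _).
  rewrite -natrM; congr (_%:R).
  transitivity (\sum_(c | tau c != th c) \sum_(e : bool) 1)%N.
    rewrite pair_big/= sum1_card; apply: eq_card => p.
    by rewrite [in RHS]unfold_in /= andbT.
  by under eq_bigr do rewrite sum1_card card_bool; rewrite sum_nat_const mulnC.
move=> x _ /=; congr EFin; rewrite /vertex -mulrBr normrM ger0_norm//.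
congr (_ * _).
have [[[c e] px]|xout] := pselect (exists p, cell (phi p) x); last first.
  by rewrite !cell_sum_out ?subrr ?normr0// => p px; apply: xout; exists p.
rewrite !(cell_sum_in phi_inj _ px)//= -mulrBr normrM ger0_norm ?exprn_ge0//.
by congr (_ * _); case: e (tau c) (th c) {px} => [] [] [] /=;
  rewrite ?subrr ?subr0 ?sub0r ?normrN ?normr1 ?normr0.
Qed.

End hypercube.

(** * From an estimator to a decoder *)

Section L1_distance.
Context (R : realType) (d : nat).
Implicit Types f g h : Rvec R d -> R.

Lemma L1distxx f : L1dist f f = 0%E.
Proof.
rewrite /L1dist Lnorm1 (eq_integral (cst 0%E)) ?integral0// => x _ /=.
by rewrite subrr normr0.
Qed.

Lemma L1dist_triangle f g h :
  measurable_fun setT f -> measurable_fun setT g -> measurable_fun setT h ->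
  (L1dist f g <= L1dist h f + L1dist h g)%E.
Proof.
move=> mf mg mh; rewrite /L1dist !Lnorm1.
have mdist (u v : Rvec R d -> R) : measurable_fun setT u ->
    measurable_fun setT v ->
    measurable_fun setT (fun x => `|(EFin \o (u \- v)%R) x|%E).
  move=> mu mv; apply: measurableT_comp => //; apply/measurable_EFinP.
  exact: measurable_funB.
rewrite -ge0_integralD//; [|exact: mdist..].
apply: ge0_le_integral => //.
- exact: mdist.
- by apply: emeasurable_funD; exact: mdist.
move=> x _ /=; rewrite -EFinD lee_fin.
rewrite (_ : f x - g x = (h x - g x) - (h x - f x)); last by lra.
by rewrite [leRHS]addrC ler_normB.
Qed.

End L1_distance.

Section hypercube_lower_bound.
Context (R : realType) (d b : nat) (C : finType).
Variable phi : C * bool -> d.-tuple 'I_b.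
Hypothesis b_gt0 : (0 < b)%N.
Hypothesis phi_inj : injective phi.
Hypothesis C_gt0 : (0 < #|C|)%N.
Variables (n : nat) (V : n.-tuple (Rvec R d) -> Rvec R d -> R) (eta : R).
Hypothesis mVx : forall X, measurable_fun setT (V X).
Hypothesis mVX : forall p : density R d,
  measurable_fun setT (fun X => L1dist (V X) p).
Hypothesis eta_ge0 : 0 <= eta.

Let vtx := vertex_density R phi b_gt0 C_gt0.

(* The decoder depends on the sample through these finitely many comparisons
   only, hence it is measurable as soon as the distances from the estimate to
   the vertices are. *)
Let close X : {ffun {ffun C -> bool} -> bool} :=
  [ffun t => (L1dist (V X) (vtx t) <= eta%:E)%E].

Let measurable_close z : measurable (close @^-1` [set z]).
Proof.
rewrite (_ : _ @^-1` _ = \bigcap_(t in [set: {ffun C -> bool}])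
    [set X | (L1dist (V X) (vtx t) <= eta%:E)%E = z t]).
  apply: fin_bigcap_measurable => [|t _]; first exact: finite_finset.
  case: (z t).
    by rewrite -[X in measurable X]setTI; exact: emeasurable_fun_infty_c.
  rewrite (_ : [set _ | _] = [set X | (eta%:E < L1dist (V X) (vtx t))%E]).
    by rewrite -[X in measurable X]setTI; exact: emeasurable_fun_o_infty.
  by apply/seteqP; split => X /=; rewrite ltNge; [move=> ->|move/negbTE].
apply/seteqP; split => [X /= <- t _ /=|X /= zX]; first by rewrite ffunE.
by apply/ffunP => t; rewrite ffunE; exact: zX.
Qed.

(* By the triangle inequality, any vertex eta-close to the estimate is as good
   a guess as a closest one: two such vertices are 2 eta-close. *)
Let decode X : {ffun C -> bool} := odflt [ffun=> true] [pick t | close X t].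

Let measurable_decode t : measurable (decode @^-1` [set t]).
Proof.
exact: (measurable_preimage_fin measurable_close
  [set z | odflt [ffun=> true] [pick t | z t] = t]).
Qed.

Let decode_far th X : eta * #|C|%:R < (hamming (decode X) th)%:R ->
  (eta%:E < L1dist (V X) (vtx th))%E.
Proof.
rewrite ltNge => /negP far; rewrite ltNge; apply/negP => Vth; apply: far.
have [t] : exists2 t, decode X = t & (L1dist (V X) (vtx t) <= eta%:E)%E.
  rewrite /decode; case: pickP => [t|none].
    by rewrite ffunE => Vt; exists t.
  by move: (none th); rewrite ffunE Vth.
move=> -> Vt; have M0 : (0 : R) < #|C|%:R by rewrite ltr0n.
have := L1dist_triangle (measurable_density (vtx t))
  (measurable_density (vtx th)) (mVx X).
move=> /le_trans/(_ (leeD Vt Vth)).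
rewrite L1dist_vertex// -EFinD lee_fin ler_pdivrMr// mulrDl.
by move=> h; lra.
Qed.

(** No estimator is accurate at all the vertices when the sample is small with
    respect to the dimension of the hypercube. *)
Lemma hypercube_lower_bound : exists th,
  (1 - n%:R / #|C|%:R) / 2 - eta <=
  fine (sample_law n (vtx th) [set X | (eta%:E < L1dist (V X) (vtx th))%E]).
Proof.
pose N c : set (n.-tuple (Rvec R d)) :=
  [set X | forall i, (~` block phi c) (tnth X i)].
have mN c : measurable (N c).
  rewrite (_ : N c = \bigcap_(i in [set: 'I_n])
      ((@tnth _ _ ^~ i) @^-1` (~` block phi c))).
    apply: fin_bigcap_measurable => // i _.
    rewrite -[X in measurable X]setTI; apply: measurable_tnth => //.
    by apply: measurableC; exact: measurable_block.
  by apply/seteqP; split => [X NX i _|X NX i]; [exact: NX|exact: NX].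
have agree th c A : measurable A -> A `<=` N c ->
    sample_law n (vtx th) A = sample_law n (vtx (flip c th)) A.
  move=> mA AN; apply: power_probability_agree AN => // B mB BN.
  apply: eq_integral => x; rewrite inE => /BN xc.
  by rewrite /= (vertex_flip phi_inj th xc).
have avoid th c : 1 - n%:R / #|C|%:R <= fine (sample_law n (vtx th) (N c)).
  apply: power_probability_avoid; first exact: measurable_block.
  exact: law_block.
have [th Qth] := assouad measurable_decode mN agree avoid eta_ge0 C_gt0.
have mfar : measurable [set X | (eta%:E < L1dist (V X) (vtx th))%E].
  by rewrite -[X in measurable X]setTI; exact: emeasurable_fun_o_infty.
have mbad : measurable
    [set X | eta * #|C|%:R < (hamming (decode X) th)%:R].
  exact: (measurable_preimage_fin measurable_decode
    [set t | eta * #|C|%:R < (hamming t th)%:R]).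
exists th; apply: (le_trans Qth); apply: fine_le; rewrite ?fin_num_measure//.
by apply: le_measure; rewrite ?inE// => X; exact: decode_far.
Qed.

End hypercube_lower_bound.

(** * Hypercubes of Tucker histograms *)

Section tucker_histograms_lemmas.
Context (R : realType).

Lemma measurable_histograms1 b (f : R -> R^o) :
  histograms1 b f -> measurable_fun setT (f : R -> R).
Proof.
apply: (@smallest_sub _ (@convex_set R _) _
    [set f : R -> R^o | measurable_fun setT (f : R -> R)]).
  move=> f1 f2 l; rewrite !inE /= => mf1 mf2.
  apply: (@measurable_funD _ _ R setT (fun x => l%:num * (f1 x : R))
    (fun x => (1 - l%:num) * (f2 x : R))); exact: measurable_funM.
by move=> _ [i _ <-]; exact: measurable_hist1.
Qed.

Lemma measurable_tucker_histogram d b k (f : Rvec R d -> R) :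
  tucker_histograms b k f -> measurable_fun setT f.
Proof.
move=> [W [p [_ hp ->]]]; apply: measurable_sum => S.
apply: measurable_funM => //; apply: measurable_prod => i _.
apply: (measurableT_comp (f := p i (tnth S i))); last exact: measurable_tnth.
exact: measurable_histograms1 (hp _ _).
Qed.

End tucker_histograms_lemmas.

Section tucker_vertices.
Context (R : realType).

Lemma convex_set_average (E : lmodType R) (A : set E) :
  @convex_set R E A ->
  forall m (F : 'I_m.+1 -> E), (forall i, A (F i)) ->
  A (m.+1%:R^-1 *: \sum_i F i).
Proof.
move=> cA; elim => [|m IH] F AF; first by rewrite invr1 scale1r big_ord1.
have l0 : (0 : R) <= m.+2%:R^-1 by rewrite invr_ge0.
have l1 : (m.+2%:R^-1 : R) <= 1 by rewrite invf_le1// ler1n.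
pose avg := m.+1%:R^-1 *: \sum_(i < m.+1) F (widen_ord (leqnSn m.+1) i).
have Aavg : A avg by apply: IH => i; exact: AF.
have := cA (F ord_max) avg (Itv01 l0 l1).
rewrite !inE => /(_ (AF _) Aavg); congr A.
rewrite [X in X = _](_ : _ =
  m.+2%:R^-1 *: F ord_max + (1 - m.+2%:R^-1) *: avg)//.
rewrite big_ord_recr/= addrC scalerDr; congr (_ + _).
rewrite scalerA; congr (_ *: _).
have m1 : (m.+1%:R : R) != 0 by rewrite pnatr_eq0.
have m2 : (m.+2%:R : R) != 0 by rewrite pnatr_eq0.
apply: (mulIf m1); rewrite mulfVK//; apply/eqP; rewrite subr_eq eq_sym.
by rewrite -[X in _ + X == _]mulr1 -mulrDr natr1 mulVf.
Qed.

(** The tensor of the mixture is the law of [psi j] for a uniform [j]. *)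
Lemma tucker_uniform_mixture d b k (J : finType) (psi : J -> d.-tuple 'I_k)
    (p : 'I_d -> 'I_k -> R -> R) :
  (0 < #|J|)%N -> (forall i j, histograms1 b (p i j)) ->
  tucker_histograms b k (fun x : Rvec R d => #|J|%:R^-1 *
    \sum_j \prod_(i < d) p i (tnth (psi j) i) (tnth x i)).
Proof.
move=> J0 hp; have J0R : (#|J|%:R : R) != 0 by rewrite pnatr_eq0 -lt0n.
exists (fun S => #|J|%:R^-1 * \sum_j (psi j == S)%:R), p; split => //.
  split=> [S|]; first by rewrite mulr_ge0 ?invr_ge0// sumr_ge0.
  rewrite -mulr_sumr exchange_big/=.
  rewrite (eq_bigr (fun=> 1)) ?sumr_const ?mulVf// => j _.
  rewrite (bigD1 (psi j))//= eqxx big1 ?addr0// => S.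
  by rewrite eq_sym => /negbTE ->.
apply/funext => x; under [RHS]eq_bigr do rewrite -mulrA mulr_suml.
rewrite -mulr_sumr exchange_big/=; congr (_ * _); apply: eq_bigr => j _.
rewrite (bigD1 (psi j))//= eqxx mul1r [X in _ + X]big1 ?addr0// => S.
by rewrite eq_sym => /negbTE ->; rewrite mul0r.
Qed.

Lemma vertexE d b (C : finType) (phi : C * bool -> d.-tuple 'I_b) th
    (x : Rvec R d) :
  vertex phi th x = #|C|%:R^-1 * \sum_c cell_density (phi (c, th c)) x.
Proof.
rewrite /vertex /cell_sum; congr (_ * _).
transitivity (\sum_c \sum_(e | e == th c) cell_density (phi (c, e)) x).
  by rewrite pair_big_dep/=; apply: eq_bigr => p _; rewrite -surjective_pairing.
by apply: eq_bigr => c _; rewrite big_pred1_eq.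
Qed.

Lemma histograms1_hist1 b (i : 'I_b) : histograms1 b (hist1 i : R -> R^o).
Proof. exact: (@sub_smallest _ _ _ [set hist1 i | i in [set: 'I_b]]). Qed.

(** With the first k bins of each axis as components, the tensor W is an
    arbitrary distribution on k^d cells. *)
Lemma vertex_tensor_tucker d b k (C : finType) (leq_kb : (k <= b)%N)
    (psi : C * bool -> d.-tuple 'I_k) (th : {ffun C -> bool}) :
  (0 < #|C|)%N ->
  tucker_histograms b k
    (vertex (fun p => map_tuple (widen_ord leq_kb) (psi p)) th : Rvec R d -> R).
Proof.
move=> C0; rewrite (_ : vertex _ th = fun x => #|C|%:R^-1 *
    \sum_c \prod_(i < d)
      hist1 (widen_ord leq_kb (tnth (psi (c, th c)) i)) (tnth x i)); last first.
  apply/funext => x; rewrite vertexE; congr (_ * _); apply: eq_bigr => c _.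
  by apply: eq_bigr => i _; rewrite tnth_map.
apply: (tucker_uniform_mixture (fun c => psi (c, th c))
  (p := fun _ j => hist1 (widen_ord leq_kb j))) => // _ j.
exact: histograms1_hist1.
Qed.

(** Uniform mixture over [j] of products whose last factors are all the bin [j]
    and whose first factor is the histogram averaging the bins
    [bins (l, th (l, j))] over [l]: the last coordinates of a point reveal the
    component it comes from, so the k first factors can be chosen separately. *)
Lemma vertex_diagonal_tucker d b k m (leq_kb : (k <= b)%N)
    (bins : 'I_m * bool -> 'I_b) (th : {ffun 'I_m * 'I_k -> bool}) :
  (0 < m)%N -> (0 < k)%N ->
  tucker_histograms b k
    (vertex (fun p : ('I_m * 'I_k) * bool =>
       [tuple of bins (p.1.1, p.2) ::
         [tuple of nseq d (widen_ord leq_kb p.1.2)]])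
     th : Rvec R d.+1 -> R).
Proof.
case: m bins th => // m bins th _ k0; set phi := (fun p => _).
pose p (i : 'I_d.+1) (j : 'I_k) : R -> R := if i == ord0
  then fun y => m.+1%:R^-1 * \sum_(l < m.+1) hist1 (bins (l, th (l, j))) y
  else hist1 (widen_ord leq_kb j).
rewrite (_ : vertex _ th = fun x => #|'I_k|%:R^-1 *
    \sum_j \prod_(i < d.+1) p i (tnth ([tuple of nseq d.+1 j]) i) (tnth x i)).
  apply: tucker_uniform_mixture; first by rewrite card_ord.
  move=> i j; rewrite /p; case: ifP => _; last exact: histograms1_hist1.
  have := @convex_set_average _ (histograms1 b) _ m
    (fun l => hist1 (bins (l, th (l, j))) : R -> R^o).
  rewrite (_ : _ *: _ =
    (fun y => m.+1%:R^-1 * \sum_(l < m.+1) hist1 (bins (l, th (l, j))) y)).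
    apply => [|l]; last exact: histograms1_hist1.
    by move=> f g l; rewrite !inE => hf hg A [cA AA]; apply/set_mem/cA;
      apply/mem_set; [exact: hf|exact: hg].
  by apply/funext => y; rewrite fctE/= fct_sumE.
apply/funext => x; rewrite vertexE card_prod !card_ord natrM invfM.
rewrite (mulrC m.+1%:R^-1) -mulrA; congr (_ * _).
transitivity (m.+1%:R^-1 *
    \sum_l \sum_j cell_density (phi ((l, j), th (l, j))) x).
  rewrite pair_bigA/=; congr (_ * _); apply: eq_bigr => lj _.
  by rewrite -surjective_pairing.
rewrite exchange_big/= mulr_sumr; apply: eq_bigr => j _.
under [RHS]eq_bigr do rewrite tnth_nseq.
rewrite [RHS]big_ord_recl /p/= -mulrA mulr_suml; congr (_ * _).
apply: eq_bigr => l _; rewrite /cell_density big_ord_recl/=.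
congr (_ * _); apply: eq_bigr => i _.
by rewrite !tnthS /= !tnth_nseq.
Qed.

End tucker_vertices.

Lemma pair_bin_subproof m (i : 'I_m./2) (e : bool) : (i.*2 + e < m)%N.
Proof. by have := ltn_ord i; have := odd_double_half m; case: e; lia. Qed.

(** The bins are grouped in pairs {2i, 2i + 1}; when m is odd, the last bin is
    left out. *)
Definition pair_bin m (p : 'I_m./2 * bool) : 'I_m :=
  Ordinal (pair_bin_subproof p.1 p.2).

Lemma pair_bin_inj m : injective (@pair_bin m).
Proof.
move=> [i e] [j e'] /(congr1 val)/= ij.
have ee' : e = e' by move/(congr1 odd): ij; rewrite !oddD !odd_double !oddb.
rewrite ee' in ij *; congr (_, _); apply: val_inj => /=.
by move/eqP: ij; rewrite eqn_add2r => /eqP/double_inj.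
Qed.

(** * The minimax lower bound *)

(** The vertices being Tucker histograms, their distance to the class is 0 and
    the deviation event of the estimator is that of [hypercube_lower_bound]. *)
Lemma tucker_risk_lower_bound (R : realType) d b k (C : finType)
    (phi : C * bool -> d.-tuple 'I_b) n
    (V : n.-tuple (Rvec R d) -> Rvec R d -> R) (eta : R) :
  (0 < b)%N -> injective phi -> (0 < #|C|)%N ->
  (forall th, tucker_histograms b k (vertex phi th : Rvec R d -> R)) ->
  estimator (@tucker_histograms R d b k) V -> 0 <= eta ->
  (((1 - n%:R / #|C|%:R) / 2 - eta)%:E <=
   ereal_sup [set sample_law n p
     [set X | (3%:E * L1dist_to p (@tucker_histograms R d b k) + eta%:E
               < L1dist (V X) p)%E] | p in [set: density R d]])%E.
Proof.
move=> b0 phi_inj C0 tucker [VC mV] eta0.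
have mVx X : measurable_fun setT (V X).
  exact: measurable_tucker_histogram (VC X).
have [th] :=
  @hypercube_lower_bound R d b C phi b0 phi_inj C0 n V eta mVx mV eta0.
set p := vertex_density _ _ _ _ _ => le_th.
apply: (@le_trans _ _ (sample_law n p
    [set X | (eta%:E < L1dist (V X) p)%E])).
  rewrite -[leRHS]fineK ?lee_fin// fin_num_measure//.
  by rewrite -[X in measurable X]setTI; exact: emeasurable_fun_o_infty.
apply: ereal_sup_ubound; exists p => //; congr (sample_law n p _).
suff -> : L1dist_to p (@tucker_histograms R d b k) = 0%E.
  by apply/funext => X /=; rewrite mule0 add0e.
apply/eqP; rewrite eq_le; apply/andP; split.
  rewrite -(L1distxx p); apply: ereal_inf_lbound.
  by exists p => //; exact: tucker.
by apply: le_ereal_inf_tmp => _ [q _ <-]; exact: Lnorm_ge0.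
Qed.

(** The constant 6 comes from k <= 3 floor(k/2) and b <= 3 floor(b/2), which
    give b k + k^d <= 3 (M1 + M2) <= 6 max(M1, M2) for the dimensions M1 and M2
    of the two hypercubes. *)
Lemma tucker_minimax (R : realType) d b k n
    (V : n.-tuple (Rvec R d.+2) -> Rvec R d.+2 -> R) (eta : R) :
  (2 <= k)%N -> (k <= b)%N ->
  estimator (@tucker_histograms R d.+2 b k) V -> 0 <= eta ->
  (((1 - 6 * (n%:R / (b * k + k ^ d.+2)%:R)) / 2 - eta)%:E <=
   ereal_sup [set sample_law n p
     [set X | (3%:E * L1dist_to p (@tucker_histograms R d.+2 b k) + eta%:E
               < L1dist (V X) p)%E] | p in [set: density R d.+2]])%E.
Proof.
move=> k2 kb est eta0.
have [k0 b0] : (0 < k)%N /\ (0 < b)%N by lia.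
suff [C [phi [phi_inj tucker C_large]]] : exists (C : finType)
    (phi : C * bool -> d.+2.-tuple 'I_b), [/\ injective phi,
    forall th, tucker_histograms b k (vertex phi th : Rvec R d.+2 -> R) &
    (b * k + k ^ d.+2 <= 6 * #|C|)%N].
  have C0 : (0 < #|C|)%N.
    by rewrite lt0n; apply: contraTN C_large => /eqP ->; rewrite muln0 -ltnNge
      addn_gt0 muln_gt0 b0 k0.
  apply: le_trans (tucker_risk_lower_bound b0 phi_inj C0 tucker est eta0).
  rewrite lee_fin lerB// ler_pM2r ?invr_gt0// lerB//.
  rewrite ler_pdivrMr ?ltr0n// (mulrA 6) mulrAC.
  rewrite ler_pdivlMr ?ltr0n ?addn_gt0 ?muln_gt0 ?b0 ?k0//.
  by rewrite -!natrM ler_nat; nia.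
have k3 : (k <= 3 * k./2)%N by lia.
have b3 : (b <= 3 * b./2)%N by lia.
have [le_AB|/ltnW le_BA] := leqP (k./2 * k ^ d.+1) (b./2 * k).
- exists ('I_b./2 * 'I_k)%type.
  exists (fun p => [tuple of pair_bin (p.1.1, p.2) ::
    nseq d.+1 (widen_ord kb p.1.2)]); split.
  + move=> [[m j] e] [[m' j'] e'] /(congr1 val)/= [mm' jj' _].
    have /pair_bin_inj[-> ->] : pair_bin (m, e) = pair_bin (m', e').
      exact: val_inj.
    by rewrite (val_inj jj' : j = j').
  + by move=> th; apply: vertex_diagonal_tucker => //; lia.
  + by rewrite card_prod !card_ord expnS; nia.
- exists ('I_k./2 * d.+1.-tuple 'I_k)%type.
  exists (fun p : ('I_k./2 * d.+1.-tuple 'I_k) * bool =>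
    map_tuple (widen_ord kb) [tuple of pair_bin (p.1.1, p.2) :: p.1.2]); split.
  + move=> [[m s] e] [[m' s'] e'] /(congr1 val)/= [mm' ss'].
    have /pair_bin_inj[-> ->] : pair_bin (m, e) = pair_bin (m', e').
      exact: val_inj.
    have widen_inj : injective (widen_ord kb).
      by move=> i j /(congr1 val)/= ?; exact: val_inj.
    by rewrite (val_inj (inj_map widen_inj ss') : s = s').
  + move=> th; apply: vertex_tensor_tucker.
    rewrite card_prod card_tuple !card_ord muln_gt0 expn_gt0 k0; lia.
  + by rewrite card_prod card_tuple !card_ord (expnS k d.+1); nia.
Qed.

Theorem theorem2p4 (R : realType) (d : nat) (b k : nat -> nat)
    (d_ge2 : (2 <= d)%N)
    (k_gt0 : forall n, (0 < k n)%N)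
    (k_le_b : forall n, (k n <= b n)%N)
    (b_oo : b n @[n --> \oo] --> \oo)
    (k_oo : k n @[n --> \oo] --> \oo)
    (rate : (n%:R / (b n * k n + k n ^ d)%:R : R) @[n --> \oo] --> (0 : R)) :
  ~ exists V : forall n, n.-tuple (Rvec R d) -> Rvec R d -> R,
      (forall n, estimator (@tucker_histograms R d (b n) (k n)) (V n)) /\
      (forall eps : R, 0 < eps ->
         ereal_sup [set sample_law n p
             [set X | (3%:E * L1dist_to p (@tucker_histograms R d (b n) (k n))
                       + eps%:E < L1dist (V n X) p)%E]
           | p in [set: density R d]]
         @[n --> \oo] --> (0 : \bar R)%E).
Proof.
case: d d_ge2 rate => [|[|d]]// _ rate [V [est consistent]].
(* With eps = 1/8 and 6 n / (b k + k^d) < 1/8, the lower bound exceeds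
   (1 - 1/8)/2 - 1/8 = 5/16 > 1/8. *)
have eighth : (0 : R) < 8^-1 by rewrite invr_gt0.
have risk_lt : \forall n \near \oo,
    (ereal_sup [set sample_law n p
       [set X | (3%:E * L1dist_to p (@tucker_histograms R d.+2 (b n) (k n))
                 + 8^-1%:E < L1dist (V n X) p)%E]
     | p in [set: density R d.+2]] < 8^-1%:E)%E.
  have nbhs0 : nbhs (0 : \bar R)%E [set x | (x < 8^-1%:E)%E].
    apply: open_nbhs_nbhs; split; first exact: open_ereal_lt_ereal.
    by rewrite /= lte_fin.
  exact: (consistent _ eighth _ nbhs0).
have rate_lt : \forall n \near \oo,
    n%:R / (b n * k n + k n ^ d.+2)%:R < 48^-1 :> R.
  by apply: (cvgr_lt _ rate); rewrite invr_gt0.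
have k_ge2 : \forall n \near \oo, (2 <= k n)%N.
  exact: k_oo (nbhs_infty_ge 2).
have [n [[risk_n rate_n] k_n]] :=
  filter_ex (filterI (filterI risk_lt rate_lt) k_ge2).
have := tucker_minimax k_n (k_le_b n) (est n) (ltW eighth).
by move=> /le_lt_trans/(_ risk_n); rewrite lte_fin; lra.
Qed.
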